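(* Let $f$ be as in the context, for $\varepsilon>0$ let $V_\varepsilon^*$ be the increasing front connecting $0$ and $1$ (regular or discontinuous according to the size of $\varepsilon$, as defined in the context), and let $$H_0(z)=\begin{cases}0 & z<0\\ 1/2 & z=0\\ 1 & z>0.\end{cases}$$ Then, as $\varepsilon\to 0^+$, $V_\varepsilon^*(z)\to H_0(z)$ for every $z\in\mathbb{R}$, and the convergence is uniform in $\mathbb{R}\setminus\mathcal{I}_0$ for every neighborhood $\mathcal{I}_0$ of the origin. Moreover, $$(V_\varepsilon^* )'\to\delta_0\qquad\text{in }\mathcal{D}'(\mathbb{R})\quad\text{as }\varepsilon\to 0^+,$$ where $(V_\varepsilon^* )'$ is the distributional derivative and $\delta_0$ is the Dirac delta distribution concentrated at $0$.
   Context: Assumptions on $f$: $f:[0,1]\to\mathbb{R}$ is continuous, $f(0)=f(1)=0$, and there is $\alpha\in(0,1)$ with $f(\alpha)=0$ and $f(s)(s-\alpha)>0$ for every $s\in(0,1)\setminus\{\alpha\}$. Moreover $\int_0^1 f(s)\,ds>0$, the derivative $f'(\alpha)$ exists and is $>0$, and $|f(s)|\le f'(\alpha)|s-\alpha|$ for every $s\in[0,1]$. Finally there is $l>0$ such that $f(s)\ge -ls$ and $f(s)\le l(1-s)$ for every $s\in[0,1]$. Notation: $f^-=\max\{-f,0\}$, $\bar\varepsilon=\int_0^1 f^-(s)\,ds$. Definition of $V_\varepsilon^*$ for $\varepsilon>\bar\varepsilon$: there is a unique $c=c_\varepsilon^*>0$ for which the equation $$\varepsilon\left(\frac{v'}{\sqrt{1+(v')^2}}\right)'-c\,v'+f(v)=0\qquad\text{on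 }\mathbb{R}$$ has an increasing solution $v\in C^2(\mathbb{R})$ with $v(-\infty)=0$, $v(+\infty)=1$; $V_\varepsilon^*$ is this solution, normalized by $v(0)=1/2$. Definition of $V_\varepsilon^*$ for $0<\varepsilon\le\bar\varepsilon$: $V_\varepsilon^*$ is the discontinuous steady state (zero speed) connecting $0$ and $1$, with its only discontinuity placed at $z=0$. Explicitly, let $v_\varepsilon^-\in(0,\alpha]$ and $v_\varepsilon^+\in(\alpha,1)$ be defined by $-\int_0^{v_\varepsilon^-}f(s)\,ds=\varepsilon=\int_{v_\varepsilon^+}^1 f(s)\,ds$. Then $V_\varepsilon^*$ is the function that is $C^2$ and increasing on $(-\infty,0)$ and on $(0,+\infty)$, solves $\varepsilon\left(\frac{v'}{\sqrt{1+(v')^2}}\right)'+f(v)=0$ on each of these two half-lines, and satisfies $v(-\infty)=0$, $v(0^-)=v_\varepsilon^-$, $v(0^+)=v_\varepsilon^+$, $v(+\infty)=1$, and $v'(z)\to+\infty$ as $z\to 0^\pm$; by convention $V_\varepsilon^*(0)=1/2$. *)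

(* Defs.v *)
From Stdlib Require Import Reals Lra Lia.
From Coquelicot Require Import Coquelicot.

Open Scope R_scope.

(** ** The reaction term *)

(** The function f : [0,1] -> R is represented by a total function on R of
    which only the values on [0,1] matter; [continuous_on] is continuity
    relative to [0,1] (one-sided at the endpoints). *)
Record bistable (f : R -> R) (alpha : R) : Prop := {
  bistable_cont : continuous_on (fun s => 0 <= s <= 1) f;
  bistable_f0 : f 0 = 0;
  bistable_f1 : f 1 = 0;
  bistable_alpha : 0 < alpha < 1;
  bistable_falpha : f alpha = 0;
  bistable_sign :
    forall s, 0 < s < 1 -> s <> alpha -> f s * (s - alpha) > 0;
  bistable_int : RInt f 0 1 > 0;
  bistable_derivable : ex_derive f alpha;
  bistable_derive_pos : Derive f alpha > 0;
  bistable_slope :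
    forall s, 0 <= s <= 1 -> Rabs (f s) <= Derive f alpha * Rabs (s - alpha);
  bistable_linear :
    exists l, 0 < l /\
      forall s, 0 <= s <= 1 -> f s >= - l * s /\ f s <= l * (1 - s)
}.

Definition neg_part (f : R -> R) (s : R) : R := Rmax (- f s) 0.

Definition eps_bar (f : R -> R) : R := RInt (neg_part f) 0 1.

(** ** Fronts *)

(** [U] is meant to be open.  The existence of the derivatives of every order
    k <= 2 has to be required: [ex_derive_n v 2 z] only says that the total
    function [Derive v] is differentiable at z. *)
Definition C2_on (U : R -> Prop) (v : R -> R) : Prop :=
  forall z, U z ->
    (forall k, (k <= 2)%nat -> ex_derive_n v k z) /\
    continuous (Derive_n v 2) z.

Definition increasing_on (U : R -> Prop) (v : R -> R) : Prop :=
  forall x y, U x -> U y -> x < y -> v x < v y.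

Definition front_equation
    (f : R -> R) (eps c : R) (v : R -> R) (z : R) : Prop :=
  eps * Derive (fun x => Derive v x / sqrt (1 + (Derive v x) ^ 2)) z
    - c * Derive v z + f (v z) = 0.

Record regular_front (f : R -> R) (eps c : R) (v : R -> R) : Prop := {
  regular_C2 : C2_on (fun _ => True) v;
  regular_incr : increasing_on (fun _ => True) v;
  regular_eq : forall z, front_equation f eps c v z;
  regular_m_infty : is_lim v m_infty 0;
  regular_p_infty : is_lim v p_infty 1;
  regular_norm : v 0 = 1 / 2
}.

Record discontinuous_steady_state
    (f : R -> R) (alpha eps : R) (vm vp : R) (v : R -> R) : Prop := {
  steady_vm : 0 < vm <= alpha;
  steady_vp : alpha < vp < 1;
  steady_vm_int : - RInt f 0 vm = eps;
  steady_vp_int : RInt f vp 1 = eps;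
  steady_C2_left : C2_on (fun z => z < 0) v;
  steady_C2_right : C2_on (fun z => 0 < z) v;
  steady_incr_left : increasing_on (fun z => z < 0) v;
  steady_incr_right : increasing_on (fun z => 0 < z) v;
  steady_eq : forall z, z <> 0 -> front_equation f eps 0 v z;
  steady_m_infty : is_lim v m_infty 0;
  steady_left : filterlim v (at_left 0) (locally vm);
  steady_right : filterlim v (at_right 0) (locally vp);
  steady_p_infty : is_lim v p_infty 1;
  steady_slope_left :
    filterlim (Derive v) (at_left 0) (Rbar_locally p_infty);
  steady_slope_right :
    filterlim (Derive v) (at_right 0) (Rbar_locally p_infty);
  steady_norm : v 0 = 1 / 2
}.

(** [v] is the front V_eps^*.  The critical speed c_eps^* is unique, so that an
    existential quantifier over c determines it. *)
Definition is_front (f : R -> R) (alpha eps : R) (v : R -> R) : Prop :=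
  (eps_bar f < eps -> exists c, 0 < c /\ regular_front f eps c v) /\
  (eps <= eps_bar f ->
     exists vm vp, discontinuous_steady_state f alpha eps vm vp v).

Definition H0 (z : R) : R :=
  if Rlt_dec z 0 then 0 else if Rlt_dec 0 z then 1 else 1 / 2.

(** ** Distributions on R *)

Record test_function : Type := {
  tf_fun :> R -> R;
  tf_smooth : forall n x, ex_derive_n tf_fun n x;
  tf_supp : exists M, forall x, M < Rabs x -> tf_fun x = 0
}.

(** Convergence of a sequence in D(R). *)
Definition test_cvg (phi : nat -> test_function) (psi : test_function) : Prop :=
  (exists M, forall n x, M < Rabs x -> phi n x = 0) /\
  forall k (e : posreal),
    eventually (fun n =>
      forall x, Rabs (Derive_n (phi n) k x - Derive_n psi k x) < e).

(** On D(R), sequential continuity of a linear functional is equivalent to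
    continuity.  Linearity is stated up to pointwise equality, so that the
    functional does not depend on the proof components of a test function. *)
Record distribution : Type := {
  distr_fun :> test_function -> R;
  distr_linear : forall (a b : R) (phi psi chi : test_function),
    (forall x, chi x = a * phi x + b * psi x) ->
    distr_fun chi = a * distr_fun phi + b * distr_fun psi;
  distr_cont : forall (phi : nat -> test_function) (psi : test_function),
    test_cvg phi psi ->
    is_lim_seq (fun n => distr_fun (phi n)) (distr_fun psi)
}.

Lemma test_smooth_derive (phi : test_function) n x :
  ex_derive_n (Derive phi) n x.
Proof.
destruct n as [|n]; [exact I|].
apply ex_derive_ext with (Derive_n phi (S n)).
- intro t. rewrite (Derive_n_comp phi n 1). f_equal. lia.
- exact (tf_smooth phi (S (S n)) x).
Qed.

Lemma derive_zero_outside (g : R -> R) M :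
  (forall x, M < Rabs x -> g x = 0) ->
  forall x, M < Rabs x -> Derive g x = 0.
Proof.
intros H x Hx.
rewrite (Derive_ext_loc g (fun _ => 0)); [apply Derive_const|].
assert (Hd : 0 < Rabs x - M) by lra.
exists (mkposreal _ Hd). intros y Hy. apply H.
change (Rabs (y - x) < Rabs x - M) in Hy.
generalize (Rabs_triang_inv x y).
rewrite (Rabs_minus_sym x y). lra.
Qed.

Lemma test_supp_derive (phi : test_function) :
  exists M, forall x, M < Rabs x -> Derive phi x = 0.
Proof.
destruct (tf_supp phi) as [M HM].
exists M. now apply derive_zero_outside.
Qed.

Definition test_derive (phi : test_function) : test_function :=
  {| tf_fun := Derive phi;
     tf_smooth := test_smooth_derive phi;
     tf_supp := test_supp_derive phi |}.

Lemma test_derive_linear (a b : R) (phi psi chi : test_function) :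
  (forall x, chi x = a * phi x + b * psi x) ->
  forall x,
    test_derive chi x = a * test_derive phi x + b * test_derive psi x.
Proof.
intros H x; simpl.
rewrite (Derive_ext _ _ _ H).
assert (H1 := tf_smooth phi 1 x). assert (H2 := tf_smooth psi 1 x).
rewrite Derive_plus.
- now rewrite !Derive_scal.
- apply (ex_derive_scal phi a x H1).
- apply (ex_derive_scal psi b x H2).
Qed.

Lemma test_derive_cvg (phi : nat -> test_function) (psi : test_function) :
  test_cvg phi psi ->
  test_cvg (fun n => test_derive (phi n)) (test_derive psi).
Proof.
intros [[M HM] H]; split.
- exists M. intro n. exact (derive_zero_outside (phi n) M (HM n)).
- intros k e. destruct (H (S k) e) as [N HN]. exists N.
  intros n Hn x. specialize (HN n Hn x). simpl tf_fun.
  change (Derive (phi n)) with (Derive_n (phi n) 1).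
  change (Derive psi) with (Derive_n psi 1).
  rewrite !Derive_n_comp. now rewrite Nat.add_1_r.
Qed.

(** <T', phi> = - <T, phi'> *)
Definition distr_derive (T : distribution) : distribution.
Proof.
refine {| distr_fun := fun phi => - T (test_derive phi) |}.
- intros a b phi psi chi H.
  rewrite (distr_linear T a b _ _ _ (test_derive_linear _ _ _ _ _ H)). ring.
- intros phi psi H.
  exact (proj1 (is_lim_seq_opp _ _) (distr_cont T _ _ (test_derive_cvg _ _ H))).
Defined.

Definition dirac0 : distribution.
Proof.
refine {| distr_fun := fun phi => phi 0 |}.
- intros a b phi psi chi H. apply H.
- intros phi psi [_ H]. apply is_lim_seq_spec. intro e.
  destruct (H 0%nat e) as [N HN]. exists N. intros n Hn. exact (HN n Hn 0).
Defined.

(** [T] is the regular distribution phi |-> int_R u phi.  The integral is a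
    (locally) Riemann one, which suffices for functions that are monotone on
    each side of 0. *)
Definition is_distr_of (u : R -> R) (T : distribution) : Prop :=
  forall phi : test_function,
    is_RInt_gen (fun x => u x * phi x)
      (Rbar_locally m_infty) (Rbar_locally p_infty) (T phi).

(** Convergence in D'(R) of a family of distributions along a filter. *)
Definition distr_cvg {I : Type} (F : (I -> Prop) -> Prop)
    (T : I -> distribution) (T0 : distribution) : Prop :=
  forall phi : test_function,
    filterlim (fun i => T i phi) F (locally (T0 phi)).

(* Main.v *)
Require Import Defs.
From Stdlib Require Import Reals Lra Lia.
From Coquelicot Require Import Coquelicot.

Open Scope R_scope.

(** For small [eps] the front is discontinuous, with values in [[0, vm]] on the
    left of 0 and in [[vp, 1]] on the right.  Since [f < 0] on [(0, alpha)] and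
    [f > 0] on [(alpha, 1)], the relations
    [- RInt f 0 vm = eps = RInt f vp 1] force [vm -> 0] and [vp -> 1], so the
    convergence to [H0] is uniform on the whole line.  The distributional
    statement follows by integrating against [- phi']. *)

(** * Integrals of functions continuous relative to [[0,1]] *)

(** A retraction of the line onto $[0,1]$. Composing with it turns continuity relative to $[0,1]$
    into two-sided continuity everywhere, which is the form that the integrability and positivity
    results for [RInt] ask for. *)
Definition clamp01 (x : R) : R := Rmax 0 (Rmin 1 x).

Lemma clamp01_range x : 0 <= clamp01 x <= 1.
Proof. unfold clamp01, Rmax, Rmin; repeat destruct Rle_dec; lra. Qed.

Lemma clamp01_id x : 0 <= x <= 1 -> clamp01 x = x.
Proof. unfold clamp01, Rmax, Rmin; repeat destruct Rle_dec; lra. Qed.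

Lemma clamp01_lipschitz x y : Rabs (clamp01 y - clamp01 x) <= Rabs (y - x).
Proof.
unfold clamp01, Rmax, Rmin, Rabs.
repeat destruct Rle_dec; repeat destruct Rcase_abs; lra.
Qed.

Lemma continuous_comp_clamp01 (g : R -> R) :
  continuous_on (fun s => 0 <= s <= 1) g ->
  forall x, continuous (fun y => g (clamp01 y)) x.
Proof.
intros Hg x P HP.
destruct (Hg (clamp01 x) (clamp01_range x) P HP) as [d Hd].
exists d. intros y Hy. apply Hd; [|apply clamp01_range].
apply Rle_lt_trans with (2 := Hy). apply clamp01_lipschitz.
Qed.

Lemma ex_RInt_unit (g : R -> R) a b :
  continuous_on (fun s => 0 <= s <= 1) g ->
  0 <= a -> a <= b -> b <= 1 -> ex_RInt g a b.
Proof.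
intros Hg Ha Hab Hb.
apply ex_RInt_ext with (fun y => g (clamp01 y)).
- rewrite Rmin_left, Rmax_right by lra.
  intros x Hx. rewrite clamp01_id by lra. reflexivity.
- apply @ex_RInt_continuous. intros z _. now apply continuous_comp_clamp01.
Qed.

Lemma RInt_unit_pos (g : R -> R) a b :
  continuous_on (fun s => 0 <= s <= 1) g ->
  0 <= a -> a < b -> b <= 1 ->
  (forall s, a < s < b -> 0 < g s) -> 0 < RInt g a b.
Proof.
intros Hg Ha Hab Hb Hpos.
rewrite (RInt_ext g (fun y => g (clamp01 y))).
- apply RInt_gt_0; [lra| |].
  + intros x Hx. rewrite clamp01_id by lra. auto.
  + intros x _. now apply continuous_comp_clamp01.
- rewrite Rmin_left, Rmax_right by lra.
  intros x Hx. rewrite clamp01_id by lra. reflexivity.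
Qed.

Lemma continuous_on_comp (D : R -> Prop) (g h : R -> R) :
  continuous_on D g -> (forall y, continuous h y) ->
  continuous_on D (fun s => h (g s)).
Proof.
intros Hg Hh x Hx.
eapply filterlim_comp; [exact (Hg x Hx)|apply Hh].
Qed.

(** * Smallness of the jump defect *)

Lemma bistable_neg f alpha (Hf : bistable f alpha) s :
  0 < s < alpha -> f s < 0.
Proof.
intros Hs. destruct (bistable_alpha _ _ Hf).
assert (H1 := bistable_sign _ _ Hf s ltac:(lra) ltac:(lra)). nra.
Qed.

Lemma bistable_pos f alpha (Hf : bistable f alpha) s :
  alpha < s < 1 -> 0 < f s.
Proof.
intros Hs. destruct (bistable_alpha _ _ Hf).
assert (H1 := bistable_sign _ _ Hf s ltac:(lra) ltac:(lra)). nra.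
Qed.

Lemma bistable_cont_opp f alpha (Hf : bistable f alpha) :
  continuous_on (fun s => 0 <= s <= 1) (fun s => - f s).
Proof.
apply (continuous_on_comp _ f Ropp); [apply (bistable_cont _ _ Hf)|].
intro y. apply (continuous_opp (fun y : R => y)). apply continuous_id.
Qed.

Lemma continuous_neg_part_value y : continuous (fun t => Rmax (- t) 0) y.
Proof.
(* The radius [e] itself works, since $t\mapsto\max(-t,0)$ is 1-Lipschitz. *)
apply filterlim_locally. intros e. exists e. intros t Ht.
change (Rabs (Rmax (- t) 0 - Rmax (- y) 0) < e).
change (Rabs (t - y) < e) in Ht. revert Ht.
unfold Rmax, Rabs; repeat destruct Rle_dec; repeat destruct Rcase_abs; lra.
Qed.

(** The negative part equals $-f>0$ on $(0,\alpha)$ and is nonnegative beyond. Positivity makes the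
    discontinuous regime $\varepsilon\le\bar\varepsilon$ cover all small positive $\varepsilon$. *)
Lemma eps_bar_pos f alpha (Hf : bistable f alpha) : 0 < eps_bar f.
Proof.
assert (Ha := bistable_alpha _ _ Hf).
assert (Hc : continuous_on (fun s => 0 <= s <= 1) (neg_part f)).
{ apply (continuous_on_comp _ f (fun t => Rmax (- t) 0));
    [apply (bistable_cont _ _ Hf)|apply continuous_neg_part_value]. }
unfold eps_bar.
rewrite <- (RInt_Chasles (neg_part f) 0 alpha 1) by
  (apply ex_RInt_unit; auto; lra).
apply Rplus_lt_le_0_compat.
- apply RInt_unit_pos; auto; try lra.
  intros s Hs. assert (f s < 0) by (eapply bistable_neg; eauto).
  unfold neg_part. rewrite Rmax_left; lra.
- apply RInt_ge_0; [lra|apply ex_RInt_unit; auto; lra|].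
  intros s _. apply Rmax_r.
Qed.

(** The area of $f$ between an endpoint of $[0,1]$ and a level on the same side of $\alpha$ grows
    strictly as the level moves away from that endpoint, so a small area forces the level to be
    close to it. The threshold [d] depends on [f] and [e] alone. *)
Lemma steady_small_jump_defect f alpha (Hf : bistable f alpha) e :
  0 < e -> exists d, 0 < d /\ forall eps vm vp,
    eps < d ->
    0 < vm <= alpha -> alpha < vp < 1 ->
    - RInt f 0 vm = eps -> RInt f vp 1 = eps -> vm <= e /\ 1 - e <= vp.
Proof.
intros He. assert (Ha := bistable_alpha _ _ Hf).
assert (Hc := bistable_cont _ _ Hf). assert (Hc' := bistable_cont_opp _ _ Hf).
(* The two caps keep $[0,e']$ to the left of $\alpha$ and $[1-e',1]$ to its right, where $f$ has a
   constant sign. *)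
set (e' := Rmin e (Rmin (alpha / 2) ((1 - alpha) / 2))).
assert (He' : 0 < e' /\ e' <= e /\ e' <= alpha / 2 /\ e' <= (1 - alpha) / 2).
{ unfold e', Rmin; repeat destruct Rle_dec; lra. }
assert (H1 : 0 < RInt (fun s => - f s) 0 e').
{ apply RInt_unit_pos; auto; try lra.
  intros s Hs. generalize (bistable_neg _ _ Hf s). lra. }
assert (H2 : 0 < RInt f (1 - e') 1).
{ apply RInt_unit_pos; auto; try lra.
  intros s Hs. apply (bistable_pos _ _ Hf). lra. }
(* The threshold is the smaller of the two areas cut off at distance [e'] from the endpoints. A
   level farther away would enclose one of them and make [eps] exceed it. *)
exists (Rmin (RInt (fun s => - f s) 0 e') (RInt f (1 - e') 1)).
split; [now apply Rmin_glb_lt|].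
intros eps vm vp Heps Hvm Hvp Im Ip.
assert (Heps1 := Rlt_le_trans _ _ _ Heps (Rmin_l _ _)).
assert (Heps2 := Rlt_le_trans _ _ _ Heps (Rmin_r _ _)).
split.
- destruct (Rle_lt_dec vm e') as [|Hlt]; [lra|exfalso].
  assert (Im' : RInt (fun s => - f s) 0 vm = eps).
  { rewrite <- Im. apply (RInt_opp f). apply ex_RInt_unit; auto; lra. }
  rewrite <- (RInt_Chasles (fun s => - f s) 0 e' vm) in Im' by
    (apply ex_RInt_unit; auto; lra).
  assert (0 < RInt (fun s => - f s) e' vm).
  { apply RInt_unit_pos; auto; try lra.
    intros s Hs. generalize (bistable_neg _ _ Hf s). lra. }
  unfold plus in Im'; simpl in Im'. lra.
- destruct (Rle_lt_dec (1 - e') vp) as [|Hlt]; [lra|exfalso].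
  rewrite <- (RInt_Chasles f vp (1 - e') 1) in Ip by
    (apply ex_RInt_unit; auto; lra).
  assert (0 < RInt f vp (1 - e')).
  { apply RInt_unit_pos; auto; try lra.
    intros s Hs. apply (bistable_pos _ _ Hf). lra. }
  unfold plus in Ip; simpl in Ip. lra.
Qed.

(** * Range and regularity of fronts *)

(** Passing to the limit $x\to-\infty$ in $v(x)<v(z)$ weakens the inequality. Keeping [U] general
    serves both a front on the whole line and a branch on a half-line. *)
Lemma increasing_ge_lim_m_infty (U : R -> Prop) v z l :
  increasing_on U v -> (forall x, x < z -> U x) -> U z ->
  is_lim v m_infty (Finite l) -> l <= v z.
Proof.
intros Hi HU Hz Hl.
apply (is_lim_le_loc v (fun _ => v z) m_infty l (v z));
  [|exact Hl|apply is_lim_const].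
exists z. intros x Hx. left. apply Hi; auto.
Qed.

Lemma increasing_le_lim_p_infty (U : R -> Prop) v z l :
  increasing_on U v -> (forall x, z < x -> U x) -> U z ->
  is_lim v p_infty (Finite l) -> v z <= l.
Proof.
intros Hi HU Hz Hl.
apply (is_lim_le_loc (fun _ => v z) v p_infty (v z) l);
  [|apply is_lim_const|exact Hl].
exists z. intros x Hx. left. apply Hi; auto.
Qed.

Lemma increasing_le_at_left v z l :
  increasing_on (fun z => z < 0) v -> z < 0 ->
  filterlim v (at_left 0) (locally l) -> v z <= l.
Proof.
intros Hi Hz Hl.
apply (filterlim_le (F := at_left 0) (fun _ => v z) v (v z) l);
  [|apply filterlim_const|exact Hl].
assert (Hd : 0 < - z) by lra.
exists (mkposreal _ Hd). intros y Hy Hy0.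
change (Rabs (y - 0) < - z) in Hy.
apply Rabs_def2 in Hy. left. apply Hi; lra.
Qed.

Lemma increasing_ge_at_right v z l :
  increasing_on (fun z => 0 < z) v -> 0 < z ->
  filterlim v (at_right 0) (locally l) -> l <= v z.
Proof.
intros Hi Hz Hl.
apply (filterlim_le (F := at_right 0) v (fun _ => v z) l (v z));
  [|exact Hl|apply filterlim_const].
exists (mkposreal _ Hz). intros y Hy Hy0.
change (Rabs (y - 0) < z) in Hy.
apply Rabs_def2 in Hy. left. apply Hi; lra.
Qed.

Lemma steady_range f alpha eps vm vp v :
  discontinuous_steady_state f alpha eps vm vp v ->
  (forall z, z < 0 -> 0 <= v z <= vm) /\ (forall z, 0 < z -> vp <= v z <= 1).
Proof.
intros []; split; intros z Hz; split.
- apply (increasing_ge_lim_m_infty (fun z => z < 0)); auto. intros; lra.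
- now apply increasing_le_at_left.
- now apply increasing_ge_at_right.
- apply (increasing_le_lim_p_infty (fun z => 0 < z)); auto. intros; lra.
Qed.

Lemma front_near_H0 f alpha (Hf : bistable f alpha) e :
  0 < e -> exists d, 0 < d /\ forall eps v,
    eps < d -> is_front f alpha eps v -> forall z, Rabs (v z - H0 z) <= e.
Proof.
intros He.
destruct (steady_small_jump_defect f alpha Hf e He) as [d [Hd Hsmall]].
(* Staying below [eps_bar f] selects the discontinuous regime; staying below [d] puts the levels
   [vm] and [vp] within [e] of 0 and 1. *)
exists (Rmin d (eps_bar f)). split.
{ apply Rmin_glb_lt; [lra|]. exact (eps_bar_pos _ _ Hf). }
intros eps v Heps [_ Hv] z.
assert (Heps1 := Rlt_le_trans _ _ _ Heps (Rmin_l _ _)).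
assert (Heps2 := Rlt_le_trans _ _ _ Heps (Rmin_r _ _)).
destruct Hv as (vm & vp & Hs); [lra|].
destruct (steady_range _ _ _ _ _ _ Hs) as [Hl Hr].
destruct (Hsmall eps vm vp Heps1 (steady_vm _ _ _ _ _ _ Hs)
  (steady_vp _ _ _ _ _ _ Hs) (steady_vm_int _ _ _ _ _ _ Hs)
  (steady_vp_int _ _ _ _ _ _ Hs)) as [Hm Hp].
unfold H0. destruct Rlt_dec as [Hz|Hz]; [|destruct Rlt_dec as [Hz'|Hz']].
- specialize (Hl z Hz). apply Rabs_le. lra.
- specialize (Hr z Hz'). apply Rabs_le. lra.
- replace z with 0 by lra. rewrite (steady_norm _ _ _ _ _ _ Hs).
  apply Rabs_le. lra.
Qed.

(** A common description of both kinds of fronts and of [H0]. The continuous extensions [ul] and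
    [ur] of the two branches give Riemann integrability on each side of 0, and the range gives the
    bound $|u|\le 1$ used in the estimates. *)
Record unit_piecewise_continuous (u : R -> R) : Prop := {
  upc_range : forall x, 0 <= u x <= 1;
  upc_sides : exists ul ur : R -> R,
    (forall x, continuous ul x) /\ (forall x, continuous ur x) /\
    (forall x, x < 0 -> u x = ul x) /\ (forall x, 0 < x -> u x = ur x)
}.

Lemma C2_on_continuous (U : R -> Prop) (v : R -> R) z :
  C2_on U v -> U z -> continuous v z.
Proof.
intros HC Hz. destruct (HC z Hz) as [HD _].
apply (ex_derive_continuous v). exact (HD 1%nat ltac:(lia)).
Qed.

Lemma continuous_left_extension (v : R -> R) (l : R) :
  (forall x, x < 0 -> continuous v x) ->
  filterlim v (at_left 0) (locally l) ->
  forall x : R, continuous (fun y => if Rlt_dec y 0 then v y else l) x.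
Proof.
intros Hc Hl x. destruct (Rtotal_order x 0) as [Hx|[->|Hx]].
- apply (continuous_ext_loc _ v); [|now apply Hc].
  apply filter_imp with (2 := open_lt 0 x Hx).
  intros y Hy. now destruct Rlt_dec.
(* At 0, points to the left are controlled by the one-sided limit, and all others are sent to [l],
   which belongs to [P]. *)
- intros P HP. destruct (Rlt_dec 0 0) as [Hx|_]; [lra|].
  destruct (Hl P HP) as [d Hd]. exists d. intros y Hy.
  destruct Rlt_dec as [Hy0|_]; [now apply Hd|now apply locally_singleton].
- apply (continuous_ext_loc _ (fun _ => l)); [|apply continuous_const].
  apply filter_imp with (2 := open_gt 0 x Hx).
  intros y Hy. destruct Rlt_dec; [lra|reflexivity].
Qed.

Lemma continuous_right_extension (v : R -> R) (l : R) :
  (forall x, 0 < x -> continuous v x) ->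
  filterlim v (at_right 0) (locally l) ->
  forall x : R, continuous (fun y => if Rlt_dec 0 y then v y else l) x.
Proof.
intros Hc Hl x. destruct (Rtotal_order x 0) as [Hx|[->|Hx]].
- apply (continuous_ext_loc _ (fun _ => l)); [|apply continuous_const].
  apply filter_imp with (2 := open_lt 0 x Hx).
  intros y Hy. destruct Rlt_dec; [lra|reflexivity].
- intros P HP. destruct (Rlt_dec 0 0) as [Hx|_]; [lra|].
  destruct (Hl P HP) as [d Hd]. exists d. intros y Hy.
  destruct Rlt_dec as [Hy0|_]; [now apply Hd|now apply locally_singleton].
- apply (continuous_ext_loc _ v); [|now apply Hc].
  apply filter_imp with (2 := open_gt 0 x Hx).
  intros y Hy. now destruct Rlt_dec.
Qed.

(** Regular fronts are covered as well, because a distribution has to be attached to the front for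
    every $\varepsilon>0$ and not only for small ones. *)
Lemma front_unit_piecewise_continuous f alpha eps v :
  is_front f alpha eps v -> unit_piecewise_continuous v.
Proof.
intros [Hreg Hdis].
destruct (Rlt_le_dec (eps_bar f) eps) as [He|He].
- destruct (Hreg He) as (c & _ & Hr). clear Hreg Hdis.
  assert (Hc : forall x, continuous v x).
  { intro x. exact (C2_on_continuous _ _ _ (regular_C2 _ _ _ _ Hr) I). }
  destruct Hr. constructor.
  + intro x. split.
    * now apply (increasing_ge_lim_m_infty (fun _ => True)).
    * now apply (increasing_le_lim_p_infty (fun _ => True)).
  + now exists v, v.
- destruct (Hdis He) as (vm & vp & Hs). clear Hreg Hdis.
  destruct (steady_range _ _ _ _ _ _ Hs) as [Hl Hr].
  destruct Hs. constructor.
  + intro x. destruct (Rtotal_order x 0) as [Hx|[->|Hx]].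
    * specialize (Hl x Hx). lra.
    * lra.
    * specialize (Hr x Hx). lra.
  (* Each branch is prolonged across 0 by its one-sided limit. *)
  + exists (fun y => if Rlt_dec y 0 then v y else vm),
      (fun y => if Rlt_dec 0 y then v y else vp).
    split; [|split; [|split]].
    * apply continuous_left_extension; auto.
      intros x Hx. now apply (C2_on_continuous (fun z => z < 0)).
    * apply continuous_right_extension; auto.
      intros x Hx. now apply (C2_on_continuous (fun z => 0 < z)).
    * intros x Hx. now destruct Rlt_dec.
    * intros x Hx. now destruct Rlt_dec.
Qed.

(** * Regular distributions *)

Lemma ex_RInt_unit_piecewise (u g : R -> R) :
  unit_piecewise_continuous u -> (forall x, continuous g x) ->
  forall a b, ex_RInt (fun x => u x * g x) a b.
Proof.
intros [_ (ul & ur & Hul & Hur & Hl & Hr)] Hg.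
(* Integrals starting at 0 see a single branch of [u]; general bounds follow by splitting at 0. *)
assert (H : forall b, ex_RInt (fun x => u x * g x) 0 b).
{ intro b. destruct (Rle_lt_dec 0 b) as [Hb|Hb].
  - apply ex_RInt_ext with (fun x => ur x * g x).
    + rewrite Rmin_left by lra. intros x Hx. rewrite Hr by lra. reflexivity.
    + apply @ex_RInt_continuous. intros x _.
      apply (continuous_mult ur g x); auto.
  - apply ex_RInt_ext with (fun x => ul x * g x).
    + rewrite Rmax_left by lra. intros x Hx. rewrite Hl by lra. reflexivity.
    + apply @ex_RInt_continuous. intros x _.
      apply (continuous_mult ul g x); auto. }
intros a b. apply ex_RInt_Chasles with 0; auto. now apply ex_RInt_swap.
Qed.

Lemma is_RInt_zero (g : R -> R) a b :
  (forall x, Rmin a b < x < Rmax a b -> g x = 0) -> is_RInt g a b 0.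
Proof.
intro H. apply is_RInt_ext with (fun _ => 0).
- intros x Hx. now rewrite H.
- assert (Hc := is_RInt_const (V := R_NormedModule) a b 0).
  change (scal (b - a) 0) with ((b - a) * 0) in Hc.
  rewrite Rmult_0_r in Hc. exact Hc.
Qed.

(** The integral is stationary: once the bounds leave $[-M,M]$, the two outer pieces contribute
    0. *)
Lemma is_RInt_gen_support (g : R -> R) M :
  0 <= M -> ex_RInt g (- M) M -> (forall x, M < Rabs x -> g x = 0) ->
  is_RInt_gen g (Rbar_locally m_infty) (Rbar_locally p_infty) (RInt g (- M) M).
Proof.
intros HM Hex Hout P HP.
apply Filter_prod with (fun x => x < - M) (fun x => M < x).
- now exists (- M).
- now exists M.
- intros a b Ha Hb. exists (RInt g (- M) M).
  split; [simpl|now apply locally_singleton].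
  replace (RInt g (- M) M) with (plus (plus 0 (RInt g (- M) M)) 0)
    by (unfold plus; simpl; ring).
  apply (is_RInt_Chasles (V := R_NormedModule) g a M b);
    [apply (is_RInt_Chasles (V := R_NormedModule) g a (- M) M)|].
  + apply is_RInt_zero. rewrite Rmin_left, Rmax_right by lra.
    intros x Hx. apply Hout. rewrite Rabs_left; lra.
  + now apply @RInt_correct.
  + apply is_RInt_zero. rewrite Rmin_left, Rmax_right by lra.
    intros x Hx. apply Hout. rewrite Rabs_pos_eq; lra.
Qed.

(** * Pairing piecewise continuous functions with test functions *)

Lemma test_continuous (phi : test_function) x : continuous phi x.
Proof. apply (ex_derive_continuous phi). exact (tf_smooth phi 1 x). Qed.

(** The improper integral avoids choosing a support radius, which [tf_supp] provides only
    existentially. *)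
Definition pairing (u : R -> R) (phi : test_function) : R :=
  RInt_gen (fun x => u x * phi x)
    (Rbar_locally m_infty) (Rbar_locally p_infty).

Lemma is_RInt_gen_pairing_support u (Hu : unit_piecewise_continuous u)
    (phi : test_function) M :
  0 <= M -> (forall x, M < Rabs x -> phi x = 0) ->
  is_RInt_gen (fun x => u x * phi x)
    (Rbar_locally m_infty) (Rbar_locally p_infty)
    (RInt (fun x => u x * phi x) (- M) M).
Proof.
intros HM Hphi. apply is_RInt_gen_support; auto.
- apply ex_RInt_unit_piecewise; auto. apply test_continuous.
- intros x Hx. rewrite (Hphi x Hx). ring.
Qed.

Lemma pairing_support u (Hu : unit_piecewise_continuous u) (phi : test_function) M :
  0 <= M -> (forall x, M < Rabs x -> phi x = 0) ->
  pairing u phi = RInt (fun x => u x * phi x) (- M) M.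
Proof.
intros HM Hphi. apply @is_RInt_gen_unique;
  try (apply Proper_StrongProper; apply Rbar_locally_filter).
now apply is_RInt_gen_pairing_support.
Qed.

Lemma test_supp_nonneg (phi : test_function) :
  exists M, 0 <= M /\ forall x, M < Rabs x -> phi x = 0.
Proof.
destruct (tf_supp phi) as [M HM]. exists (Rmax 0 M). split.
- apply Rmax_l.
- intros x Hx. apply HM. generalize (Rmax_r 0 M). lra.
Qed.

Lemma is_RInt_gen_pairing u (Hu : unit_piecewise_continuous u) (phi : test_function) :
  is_RInt_gen (fun x => u x * phi x)
    (Rbar_locally m_infty) (Rbar_locally p_infty) (pairing u phi).
Proof.
destruct (test_supp_nonneg phi) as (M & HM & Hphi).
rewrite (pairing_support u Hu phi M HM Hphi).
now apply is_RInt_gen_pairing_support.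
Qed.

Lemma pairing_linear u (Hu : unit_piecewise_continuous u) (a b : R)
    (phi psi chi : test_function) :
  (forall x, chi x = a * phi x + b * psi x) ->
  pairing u chi = a * pairing u phi + b * pairing u psi.
Proof.
intros H. apply @is_RInt_gen_unique;
  try (apply Proper_StrongProper; apply Rbar_locally_filter).
apply is_RInt_gen_ext with
  (fun x => plus (scal a (u x * phi x)) (scal b (u x * psi x))).
- apply filter_forall. intros ab x _. rewrite H.
  unfold plus, scal; simpl; unfold mult; simpl. ring.
- apply @is_RInt_gen_plus; try apply Rbar_locally_filter;
    apply @is_RInt_gen_scal; try apply Rbar_locally_filter;
    now apply is_RInt_gen_pairing.
Qed.

(** Both pairings are integrals over $[-M,M]$, of length $2M$, and $|u|\le 1$ there. *)
Lemma pairing_diff_le u (Hu : unit_piecewise_continuous u)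
    (phi psi : test_function) M e :
  0 <= M ->
  (forall x, M < Rabs x -> phi x = 0) -> (forall x, M < Rabs x -> psi x = 0) ->
  (forall x, Rabs (phi x - psi x) <= e) ->
  Rabs (pairing u phi - pairing u psi) <= 2 * M * e.
Proof.
intros HM Hphi Hpsi He.
rewrite (pairing_support u Hu phi M), (pairing_support u Hu psi M) by auto.
assert (Hx := ex_RInt_unit_piecewise u phi Hu (test_continuous phi)
  (- M) M).
assert (Hy := ex_RInt_unit_piecewise u psi Hu (test_continuous psi)
  (- M) M).
assert (Hm := RInt_minus _ _ _ _ Hx Hy). unfold minus, plus, opp in Hm.
simpl in Hm. unfold Rminus at 1. rewrite <- Hm.
replace (2 * M * e) with ((M - - M) * e) by ring.
apply abs_RInt_le_const; [lra| |].
- apply (ex_RInt_minus (V := R_NormedModule) _ _ _ _ Hx Hy).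
- intros t _.
  replace (u t * phi t + - (u t * psi t)) with (u t * (phi t - psi t)) by ring.
  rewrite Rabs_mult. destruct (upc_range u Hu t).
  rewrite (Rabs_pos_eq (u t)) by lra.
  generalize (He t) (Rabs_pos (phi t - psi t)). nra.
Qed.

Lemma pairing_cont u (Hu : unit_piecewise_continuous u)
    (phi : nat -> test_function) (psi : test_function) :
  test_cvg phi psi ->
  is_lim_seq (fun n => pairing u (phi n)) (pairing u psi).
Proof.
intros [[M1 HM1] H].
destruct (test_supp_nonneg psi) as (M2 & HM2 & Hpsi).
set (M := Rmax M1 M2).
assert (HM1' : M1 <= M) by apply Rmax_l.
assert (HM2' : M2 <= M) by apply Rmax_r.
apply is_lim_seq_spec. intro e.
(* Dividing by $2M+1$ instead of $2M$ allows $M=0$ and makes the final bound strict. *)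
assert (He : 0 < e / (2 * M + 1)).
{ apply Rdiv_lt_0_compat; [apply cond_pos|lra]. }
destruct (H 0%nat (mkposreal _ He)) as [N HN].
exists N. intros n Hn. specialize (HN n Hn). simpl in HN.
apply Rle_lt_trans with (2 * M * (e / (2 * M + 1))).
- apply pairing_diff_le; auto; try lra.
  + intros x Hx. apply HM1. lra.
  + intros x Hx. apply Hpsi. lra.
  + intros x. left. apply HN.
- replace (pos e) with ((2 * M + 1) * (e / (2 * M + 1))) at 2 by (field; lra).
  nra.
Qed.

Definition regular_distribution u (Hu : unit_piecewise_continuous u) : distribution :=
  {| distr_fun := pairing u;
     distr_linear := pairing_linear u Hu;
     distr_cont := pairing_cont u Hu |}.

(** * The Heaviside function and its derivative *)

Lemma H0_unit_piecewise_continuous : unit_piecewise_continuous H0.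
Proof.
constructor.
- intro x. unfold H0. repeat destruct Rlt_dec; lra.
- exists (fun _ => 0), (fun _ => 1).
  split; [|split; [|split]]; try (intro; apply continuous_const);
    intros x Hx; unfold H0; repeat destruct Rlt_dec; lra.
Qed.

(** This is $H_0'=\delta_0$ in weak form: only $\int_0^{M'}\varphi'$ survives, and it equals
    $\varphi(M')-\varphi(0)$ with $\varphi(M')=0$. *)
Lemma pairing_H0_derive (phi : test_function) :
  pairing H0 (test_derive phi) = - phi 0.
Proof.
destruct (test_supp_nonneg phi) as (M & HM & Hphi).
(* The test function is known to vanish only where $|x|>M$ strictly, so the enlarged radius secures
   $\varphi(M')=0$. *)
set (M' := M + 1).
assert (HM' : forall x, M' < Rabs x -> phi x = 0).
{ intros x Hx. apply Hphi. unfold M' in Hx. lra. }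
rewrite (pairing_support _ H0_unit_piecewise_continuous _ M');
  [|unfold M'; lra|exact (derive_zero_outside _ _ HM')].
assert (Hex := ex_RInt_unit_piecewise _ (test_derive phi)
  H0_unit_piecewise_continuous (test_continuous (test_derive phi))).
rewrite <- (RInt_Chasles (fun x => H0 x * test_derive phi x) (- M') 0 M')
  by apply Hex.
rewrite (RInt_ext _ (fun _ => 0) (- M') 0).
2:{ unfold M'. rewrite Rmin_left, Rmax_right by lra. intros x Hx.
    unfold H0. destruct Rlt_dec; simpl; lra. }
rewrite (RInt_ext _ (Derive phi) 0 M').
2:{ unfold M'. rewrite Rmin_left, Rmax_right by lra. intros x Hx.
    unfold H0. destruct Rlt_dec; [lra|]. destruct Rlt_dec; simpl; lra. }
rewrite RInt_const, RInt_Derive.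
- rewrite (Hphi M') by (unfold M'; rewrite Rabs_pos_eq; lra).
  unfold plus, scal; simpl; unfold mult; simpl. ring.
- intros x _. exact (tf_smooth phi 1 x).
- intros x _. exact (test_continuous (test_derive phi) x).
Qed.

(** * Dependence of the pairing on the paired function *)

Lemma test_bounded (phi : test_function) :
  exists K, 0 <= K /\ forall x, Rabs (phi x) <= K.
Proof.
destruct (test_supp_nonneg phi) as (M & HM & Hphi).
destruct (bounded_continuity phi (- M) M) as [K HK].
{ intros x _. apply test_continuous. }
exists (Rmax 0 K). split; [apply Rmax_l|]. intro x.
destruct (Rle_lt_dec (Rabs x) M) as [Hx|Hx].
- apply Rabs_le_between in Hx. generalize (HK x Hx) (Rmax_r 0 K).
  change (norm (phi x)) with (Rabs (phi x)). lra.
- rewrite (Hphi x Hx), Rabs_R0. apply Rmax_l.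
Qed.

(** The constant is $2M\sup|\varphi|$ up to the choice of bound. It is fixed before [u] and [w], so
    uniform closeness of the fronts to [H0] passes to their pairings. *)
Lemma pairing_uniform_le (phi : test_function) :
  exists C, 0 <= C /\ forall u w e,
    unit_piecewise_continuous u -> unit_piecewise_continuous w ->
    (forall x, Rabs (u x - w x) <= e) ->
    Rabs (pairing u phi - pairing w phi) <= C * e.
Proof.
destruct (test_supp_nonneg phi) as (M & HM & Hphi).
destruct (test_bounded phi) as (K & HK & Hb).
exists (2 * M * K). split; [nra|]. intros u w e Hu Hw He.
rewrite (pairing_support u Hu phi M), (pairing_support w Hw phi M) by auto.
assert (Hx := ex_RInt_unit_piecewise u phi Hu (test_continuous phi)
  (- M) M).
assert (Hy := ex_RInt_unit_piecewise w phi Hw (test_continuous phi)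
  (- M) M).
assert (Hm := RInt_minus _ _ _ _ Hx Hy). unfold minus, plus, opp in Hm.
simpl in Hm. unfold Rminus at 1. rewrite <- Hm.
replace (2 * M * K * e) with ((M - - M) * (e * K)) by ring.
apply abs_RInt_le_const; [lra| |].
- apply (ex_RInt_minus (V := R_NormedModule) _ _ _ _ Hx Hy).
- intros t _.
  replace (u t * phi t + - (w t * phi t)) with ((u t - w t) * phi t) by ring.
  rewrite Rabs_mult.
  apply Rmult_le_compat; auto; apply Rabs_pos.
Qed.

Theorem theorem3p4 (f : R -> R) (alpha : R) (V : R -> R -> R)
    (Hf : bistable f alpha)
    (HV : forall eps, 0 < eps -> is_front f alpha eps (V eps)) :
  (forall z, filterlim (fun eps => V eps z) (at_right 0) (locally (H0 z))) /\
  (forall I0 : R -> Prop, locally 0 I0 ->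
     forall e : posreal,
       at_right 0 (fun eps =>
         forall z, ~ I0 z -> Rabs (V eps z - H0 z) < e)) /\
  (exists T : R -> distribution,
     (forall eps, 0 < eps -> is_distr_of (V eps) (T eps)) /\
     distr_cvg (at_right 0) (fun eps => distr_derive (T eps)) dirac0).
Proof.
(* Positivity of [eps] is kept in the event because the distributions built below are tied to the
   fronts only for $\varepsilon>0$. *)
assert (Hunif : forall e, 0 < e ->
  at_right 0 (fun eps => 0 < eps /\ forall z, Rabs (V eps z - H0 z) <= e)).
{ intros e He. destruct (front_near_H0 f alpha Hf e He) as (d & Hd & Hnear).
  exists (mkposreal d Hd). intros eps Hball Hpos. split; [exact Hpos|].
  change (Rabs (eps - 0) < d) in Hball. apply Rabs_def2 in Hball.
  apply (Hnear eps); [lra|]. now apply HV. }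
assert (Hunif' : forall e : posreal,
  at_right 0 (fun eps => forall z, Rabs (V eps z - H0 z) < e)).
{ intro e. assert (He := cond_pos e).
  apply filter_imp with (2 := Hunif (e / 2) ltac:(lra)).
  intros eps [_ H] z. specialize (H z). lra. }
split; [|split].
- intro z. apply filterlim_locally. intro e.
  apply filter_imp with (2 := Hunif' e). intros eps H. exact (H z).
- intros I0 _ e. apply filter_imp with (2 := Hunif' e). auto.
(* For $\varepsilon\le 0$ the value [dirac0] is a placeholder, invisible to the filter
   [at_right 0]. *)
- set (T := fun eps => match Rlt_dec 0 eps with
    | left H => regular_distribution (V eps)
        (front_unit_piecewise_continuous f alpha eps _ (HV eps H))
    | right _ => dirac0 end).
  assert (HT : forall eps phi, 0 < eps -> T eps phi = pairing (V eps) phi).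
  { intros eps phi Heps. unfold T. now destruct Rlt_dec. }
  exists T. split.
  + intros eps Heps phi. rewrite HT by auto. apply is_RInt_gen_pairing.
    eapply front_unit_piecewise_continuous; eauto.
  + intros phi. apply filterlim_locally. intro e.
    destruct (pairing_uniform_le (test_derive phi)) as (C & HC & Hle).
    assert (He : 0 < e / (C + 1)).
    { apply Rdiv_lt_0_compat; [apply cond_pos|lra]. }
    apply filter_imp with (2 := Hunif _ He). intros eps [Hpos Hz].
    change (Rabs (- T eps (test_derive phi) - phi 0) < e).
    rewrite HT by auto.
    (* Writing $\varphi(0)$ as $-\langle H_0,\varphi'\rangle$ turns the error into the pairing of
       $V_\varepsilon^*-H_0$ with $\varphi'$, up to sign. *)
    replace (- pairing (V eps) (test_derive phi) - phi 0) with
      (- (pairing (V eps) (test_derive phi) - pairing H0 (test_derive phi)))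
      by (rewrite pairing_H0_derive; ring).
    rewrite Rabs_Ropp.
    apply Rle_lt_trans with (C * (e / (C + 1))).
    * apply Hle; auto; [|apply H0_unit_piecewise_continuous].
      eapply front_unit_piecewise_continuous; eauto.
    * replace (pos e) with ((C + 1) * (e / (C + 1))) at 2 by (field; lra).
      nra.
Qed.
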